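(* Let $(\mathfrak g,[\,,\,],\langle\,,\,\rangle)$ be a pseudo-Euclidean Lie algebra over $\mathbb K$. If $(\mathfrak g,[\,,\,],\langle\,,\,\rangle)$ is flat in the classical Lie algebra curvature sense, i.e. $K_0=0$, then it is also flat as a Malcev algebra, i.e. $K=0$.
   Context: $\mathbb K$ is a field of characteristic zero; vector spaces are finite dimensional. A pseudo-Euclidean Lie algebra is a Lie algebra with a non-degenerate symmetric bilinear form $\langle\,,\,\rangle$. The Levi-Civita product $\bullet$ is defined by $2\langle u\bullet v,w\rangle=\langle[u,v],w\rangle-\langle[v,w],u\rangle+\langle[w,u],v\rangle$; $\mathrm L_u(v)=u\bullet v$. The two curvatures are $$K_0(u,v)=\mathrm L_{[u,v]}-[\mathrm L_u,\mathrm L_v],$$ $$K(u,v,w)=\mathrm L_{[[u,v],w]}-\mathrm L_{[u,w]}\circ\mathrm L_v-\mathrm L_u\circ\mathrm L_{[v,w]}+\mathrm L_v\circ\mathrm L_u\circ\mathrm L_w-\mathrm L_w\circ\mathrm L_v\circ\mathrm L_u.$$ *)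

(* Defs.v *)
From HB Require Import structures.
From mathcomp Require Import all_boot all_order all_algebra ring.

Set Implicit Arguments.
Unset Strict Implicit.
Unset Printing Implicit Defensive.

Import GRing.Theory.
Local Open Scope ring_scope.

Definition is_lie_bracket (K : fieldType) (g : vectType K)
    (br : {bilinear g -> g -> g}) : Prop :=
  (forall u, br u u = 0) /\
  (forall u v w, br (br u v) w + br (br v w) u + br (br w u) v = 0).

Section LeviCivita.
Variables (K : fieldType) (g : vectType K).
Variables (br : {bilinear g -> g -> g}) (form : {symmetric g}).
Implicit Types u v w : g.

Definition koszul u v w : K :=
  form (br u v) w - form (br v w) u + form (br w u) v.

Definition form_dual u : 'Hom(g, K^o) := linfun (form u : g -> K^o).

(* The inverse of the linear map form_dual, applied to the functional
   koszul u v, gives the vector representing it when form is nondegenerate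
   (see levi_civitaP); without this hypothesis the value is meaningless. *)
Definition levi_civita u v : g :=
  2^-1 *: ((linfun form_dual)^-1)%VF (linfun (koszul u v : g -> K^o)).

Lemma koszul_linearr u v : linear (koszul u v : g -> K^o).
Proof.
move=> a x y.
suff: koszul u v (a *: x + y) = a * koszul u v x + koszul u v y by [].
rewrite /koszul.
rewrite !(linearDl, linearDr) !(linearZl_LR, linearZr_LR) /=.
ring.
Qed.

Lemma koszul_linearm u w : linear (fun v => koszul u v w : K^o).
Proof.
move=> a x y.
suff: koszul u (a *: x + y) w = a * koszul u x w + koszul u y w by [].
rewrite /koszul.
rewrite !(linearDl, linearDr) !(linearZl_LR, linearZr_LR) /=.
ring.
Qed.

HB.instance Definition _ u v :=
  GRing.isLinear.Build K g K^o *:%R (koszul u v) (koszul_linearr u v).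

Lemma form_dual_linear : linear form_dual.
Proof.
move=> a x y; apply/lfunP => w.
by rewrite add_lfunE scale_lfunE !lfunE /= linearDl linearZl_LR.
Qed.

HB.instance Definition _ :=
  GRing.isLinear.Build K g 'Hom(g, K^o) *:%R form_dual form_dual_linear.

Lemma levi_civita_linear u : linear (levi_civita u).
Proof.
move=> a x y; rewrite /levi_civita.
have -> : linfun (koszul u (a *: x + y) : g -> K^o) =
    a *: linfun (koszul u x : g -> K^o) + linfun (koszul u y : g -> K^o).
  apply/lfunP => w; rewrite add_lfunE scale_lfunE !lfunE /=.
  exact: koszul_linearm.
by rewrite linearP /= scalerDr !scalerA mulrC.
Qed.

HB.instance Definition _ u :=
  GRing.isLinear.Build K g g *:%R (levi_civita u) (levi_civita_linear u).

Lemma levi_civitaP u v w : has_pchar0 K -> nondegenerate form ->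
  2 * form (levi_civita u v) w =
    form (br u v) w - form (br v w) u + form (br w u) v.
Proof.
move=> /pcharf0P char0 /eqP nd.
have ker0 : lker (linfun form_dual) == 0%VS.
  rewrite -subv0 -nd; apply/subvP => x.
  rewrite memv_ker lfunE /= => /eqP x0; apply/mem_orthovP => y _.
  by have := congr1 (fun h : 'Hom(g, K^o) => h y) x0; rewrite lfunE /= lfunE.
have img : limg (linfun form_dual) = fullv.
  apply/eqP; rewrite eqEdim subvf /= limg_dim_eq; last first.
    by rewrite (eqP ker0) capv0.
  by rewrite !dimvf /dim /= muln1.
have /lfunP/(_ w) : form_dual (2 *: levi_civita u v)
    = linfun (koszul u v : g -> K^o).
  rewrite /levi_civita scalerA mulfV ?char0 // scale1r.
  have {1}<- := lfunE form_dual; rewrite limg_lfunVK ?img ?memvf //.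
by rewrite !lfunE /= linearZl_LR.
Qed.

Definition levi_civita_mul u : 'End(g) := linfun (levi_civita u).

Local Notation L := levi_civita_mul.

Lemma levi_civita_mulE u v : L u v = levi_civita u v.
Proof. by rewrite lfunE. Qed.

Definition lie_curvature u v : 'End(g) :=
  L (br u v) - ((L u \o L v)%VF - (L v \o L u)%VF).

Definition malcev_curvature u v w : 'End(g) :=
  L (br (br u v) w) - (L (br u w) \o L v)%VF - (L u \o L (br v w))%VF
  + (L v \o L u \o L w)%VF - (L w \o L v \o L u)%VF.

End LeviCivita.

(* Main.v *)
Require Import Defs.
From mathcomp Require Import all_boot all_order all_algebra.

Import GRing.Theory.
Local Open Scope ring_scope.

(** Flatness [K_0 = 0] says that [u |-> L_u] turns brackets into commutators
of endomorphisms.  Each of the three operators [L_{[[u,v],w]}], [L_{[u,w]}]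
and [L_{[v,w]}] occurring in [K(u,v,w)] then becomes a combination of words
in [L_u], [L_v], [L_w]; writing [u] for [L_u],
- [L_{[[u,v],w]} = uvw - vuw - wuv + wvu],
- [L_{[u,w]} v = uwv - wuv],
- [u L_{[v,w]} = uvw - uwv],
and [K(u,v,w)] is the first line minus the other two, plus [vuw - wvu], where
all words cancel in pairs. *)

Lemma lie_flat_bracketE (K : fieldType) (g : vectType K)
    (br : {bilinear g -> g -> g}) (form : {symmetric g}) (u v x : g) :
  lie_curvature br form u v = 0 ->
  levi_civita_mul br form (br u v) x =
    levi_civita_mul br form u (levi_civita_mul br form v x)
    - levi_civita_mul br form v (levi_civita_mul br form u x).
Proof.
move=> /eqP; rewrite subr_eq0 => /eqP ->.
by rewrite add_lfunE opp_lfunE !comp_lfunE.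
Qed.

Theorem proposition2p17 (K : fieldType) (charK : has_pchar0 K)
    (g : vectType K) (br : {bilinear g -> g -> g}) (form : {symmetric g})
    (lie_br : is_lie_bracket br) (nondeg_form : nondegenerate form) :
  (forall u v : g, lie_curvature br form u v = 0) ->
  forall u v w : g, malcev_curvature br form u v w = 0.
Proof.
move=> flat u v w; apply/lfunP => x; rewrite /malcev_curvature.
rewrite !(add_lfunE, opp_lfunE, comp_lfunE, zero_lfunE).
rewrite !(fun a b y => @lie_flat_bracketE _ _ _ _ a b y (flat a b)) !linearB /=.
set L := levi_civita_mul br form.
move: (L u (L v (L w x))) (L v (L u (L w x))) (L w (L u (L v x)))
  (L w (L v (L u x))) (L u (L w (L v x))) => uvw vuw wuv wvu uwv.
rewrite !opprK !(addrC (- _)) (addrA (uvw - vuw)) !subrKA.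
by rewrite (addrAC _ wvu) (addrAC uvw) subrr sub0r
  (addrAC _ wvu) addNr add0r subrr.
Qed.
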